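(* The map $\gamma$ (defined in the context on restricted growth functions avoiding $12231$) is a size-preserving bijection between $\mathcal{R}(12321)$ and $\mathcal{R}(12231)$. Moreover, $\gamma$ preserves the maximum value of a restricted growth function.
   Context: A restricted growth function (RGF) of length $n$ is a sequence of positive integers $r_1\cdots r_n$ with $r_1=1$ and $r_i\le 1+\max\{r_1,\dots,r_{i-1}\}$ for $i\ge2$. The standardization $\mathrm{std}(Q)$ of an integer sequence replaces all occurrences of its $i$-th smallest distinct value by $i$, for all $i$. An RGF $R$ contains $Q$ if some subsequence of $R$ (an occurrence of $Q$) has standardization equal to $Q$; otherwise it avoids $Q$. $\mathcal{R}(Q)$ is the set of all RGFs (of all lengths $n\ge1$) avoiding $Q$. The size of an RGF is its length. An RGF avoids $12321$ if and only if it avoids $321$. For an RGF $R=r_1\cdots r_n$ containing $321$, let $\mathrm{rm}(R,321)=i_1i_2i_3$ be the index triple ($i_1<i_2<i_3$) of the lexicographically rightmost occurrence $r_{i_1}r_{i_2}r_{i_3}$ of $321$ in $R$: for any other occurrence $r_{j_1}r_{j_2}r_{j_3}$ of $321$, either $j_1<i_1$, or $j_1=i_1$ and $j_2<i_2$, or $j_1=i_1$, $j_2=i_2$ and $j_3<i_3$. The map $\gamma$ takes $R\in\mathcal{R}(12231)$ and is defined recursively: set $R^{(0)}=R$; for $t\ge0$, if $R^{(t)}$ contains $321$, then $R^{(t+1)}$ is obtained from $R^{(t)}$ by exchanging the elements in positions $i_1$ and $i_2$, where $i_1i_2i_3=\mathrm{rm}(R^{(t)},321)$. Each $R^{(t)}$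 is an RGF and the process terminates; $\gamma(R)=R^{(k)}$, where $k$ is the minimum index such that $R^{(k)}$ avoids $321$. *)

(* Defs.v *)
From mathcomp Require Import all_boot all_order.
From mathcomp Require Import classical_sets functions.
From mathcomp Require Import zify.

Set Implicit Arguments.
Unset Strict Implicit.
Unset Printing Implicit Defensive.

Import Order.TTheory.

(* Positions are numbered from 0. *)

Definition is_rgf (r : seq nat) : bool :=
  [&& 0 < size r, all (leq 1) r, nth 0 r 0 == 1
    & [forall i : 'I_(size r), (0 < i) ==>
         (nth 0 r i <= 1 + \max_(j < i) nth 0 r j)]].

Definition std (q : seq nat) : seq nat :=
  [seq (index x (sort leq (undup q))).+1 | x <- q].

Definition occurrence (q r : seq nat) (t : (size q).-tuple 'I_(size r)) : bool :=
  sorted ltn [seq val i | i <- t] &&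
  (std [seq nth 0 r i | i : 'I_(size r) <- t] == q).

Definition contains (r q : seq nat) : bool := [exists t, @occurrence q r t].

Definition avoids (r q : seq nat) : bool := ~~ contains r q.

Definition RGF_avoiding (q : seq nat) : set (seq nat) :=
  [set r | is_rgf r && avoids r q]%classic.

(* Order.le on tuplelexi is the lexicographic order on position tuples; the
   value is None exactly when r avoids q (see rm_contains). *)
Definition rm (r q : seq nat) : option ((size q).-tuple 'I_(size r)) :=
  [pick t | @occurrence q r t &&
     [forall u, @occurrence q r u ==>
        (u <= t :> (size q).-tuplelexi 'I_(size r))%O]].

Definition exchange (r : seq nat) (i j : nat) : seq nat :=
  set_nth 0 (set_nth 0 r i (nth 0 r j)) j (nth 0 r i).

Definition gamma_step (r : seq nat) : seq nat :=
  if rm r [:: 3; 2; 1] is Some t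
  then exchange r (tnth t (inord 0)) (tnth t (inord 1)) else r.

Lemma rm_contains (r q : seq nat) : isSome (rm r q) = contains r q.
Proof.
rewrite /rm /contains; case: pickP => [t /andP[occ_t _]|no_t].
  by apply/esym/existsP; exists t.
apply/esym/negbTE/existsP => -[t0 occ_t0].
have := @arg_maxP _ ((size q).-tuplelexi 'I_(size r)) _ t0 (@occurrence q r) id occ_t0.
case=> t occ_t max_t; have := no_t t; rewrite /= occ_t /= => /negP; apply.
by apply/forallP => u; apply/implyP => /max_t.
Qed.

Lemma size_exchange r i j : i < size r -> j < size r ->
  size (exchange r i j) = size r.
Proof.
by move=> ir jr; rewrite !size_set_nth (maxn_idPr ir) (maxn_idPr jr).
Qed.

Lemma nth_exchange r i j k : nth 0 (exchange r i j) k =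
  if k == j then nth 0 r i else if k == i then nth 0 r j else nth 0 r k.
Proof. by rewrite /exchange !nth_set_nth /= nth_set_nth. Qed.

Lemma gamma_step_exchange r : contains r [:: 3; 2; 1] ->
  exists i j, [/\ i < j, j < size r, nth 0 r j < nth 0 r i
    & gamma_step r = exchange r i j].
Proof.
rewrite -rm_contains /gamma_step /rm.
case: pickP => // t /andP[/andP[lt_t std_t] _] _.
exists (tnth t (inord 0)), (tnth t (inord 1)).
have e0 : tnth t (inord 0) = thead t by congr tnth; apply/val_inj; rewrite /= inordK.
have e1 : tnth t (inord 1) = thead (behead_tuple t).
  by rewrite /thead tnth_behead; congr tnth; apply/val_inj; rewrite /= !inordK.
rewrite {}e0 {}e1; case/tupleP: t lt_t std_t => a t.
case/tupleP: t => b t; case/tupleP: t => c t; rewrite (tuple0 t) /=.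
rewrite /thead !(tnth_nth a) /= => /andP[lt_ab _] /eqP std_abc; split=> //.
move: std_abc; rewrite /std; set x := nth 0 r a; set y := nth 0 r b.
set z := nth 0 r c; set q := [:: x; y; z]; set s := sort _ _.
have mem_s u : (u \in s) = (u \in q) by rewrite mem_sort mem_undup.
have sorted_s : sorted leq s by apply: sort_sorted; exact: leq_total.
move=> [idx_x idx_y _].
have := sorted_ltn_index leq_trans sorted_s y x.
rewrite !mem_s idx_x idx_y !inE !eqxx orbT => /(_ isT isT isT) le_yx.
rewrite ltn_neqAle le_yx andbT; apply/eqP => e_yx.
by move: idx_x; rewrite -e_yx idx_y.
Qed.

Definition weight (r : seq nat) : nat := \sum_(i < size r) i * nth 0 r i.

Lemma weight_exchange r i j : i < j -> j < size r -> nth 0 r j < nth 0 r i ->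
  weight r < weight (exchange r i j).
Proof.
move=> ij jr lt_ji; have ir := ltn_trans ij jr.
rewrite /weight size_exchange //.
have neq : Ordinal ir != Ordinal jr by rewrite -val_eqE /= neq_ltn ij.
rewrite (bigD1 (Ordinal jr)) //= (bigD1 (Ordinal ir)) //=.
rewrite [X in _ < X](bigD1 (Ordinal jr)) //= [X in _ < _ + X](bigD1 (Ordinal ir)) //=.
have -> : \sum_(k < size r | (k != Ordinal jr) && (k != Ordinal ir))
    k * nth 0 (exchange r i j) k =
  \sum_(k < size r | (k != Ordinal jr) && (k != Ordinal ir)) k * nth 0 r k.
  apply: eq_bigr => k /andP[]; rewrite -!val_eqE /= nth_exchange.
  by move=> /negbTE-> /negbTE->.
rewrite !nth_exchange !eqxx (ltn_eqF ij) !addnA ltn_add2r; nia.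
Qed.

Lemma gamma_terminates (r : seq nat) :
  exists k, avoids (iter k gamma_step r) [:: 3; 2; 1].
Proof.
pose M := \max_(x <- r) x; pose K := \sum_(i < size r) i * M.
have bound s : size s = size r -> (forall k, nth 0 s k <= M) -> weight s <= K.
  by move=> ss sM; rewrite /weight ss; apply: leq_sum => i _; rewrite leq_mul2l sM orbT.
have r_M k : nth 0 r k <= M.
  have [lt_kr|le_rk] := ltnP k (size r); last by rewrite nth_default.
  by rewrite /M (big_nth 0) big_mkord (leq_bigmax (Ordinal lt_kr)).
suff main m s : size s = size r -> (forall k, nth 0 s k <= M) ->
    K - weight s < m -> exists k, avoids (iter k gamma_step s) [:: 3; 2; 1].
  exact: (main (K - weight r).+1).
elim: m s => // m IHm s s_r s_M lt_m.
have [c|av] := boolP (contains s [:: 3; 2; 1]); last by exists 0.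
have [i [j [lt_ij lt_js lt_ji e]]] := gamma_step_exchange c.
have sz_e : size (gamma_step s) = size r.
  by rewrite e size_exchange // (ltn_trans lt_ij).
have e_M k : nth 0 (gamma_step s) k <= M.
  by rewrite e nth_exchange; case: ifP => // _; case: ifP.
have [|k av] := IHm (gamma_step s) sz_e e_M; last by exists k.+1; rewrite iterSr.
have := weight_exchange lt_ij lt_js lt_ji; rewrite -e.
have := bound _ sz_e e_M; lia.
Qed.

Definition gamma (r : seq nat) : seq nat :=
  iter (ex_minn (gamma_terminates r)) gamma_step r.

(* Main.v *)
Require Import Defs.
From mathcomp Require Import all_boot all_order.
From mathcomp Require Import classical_sets functions.
From mathcomp Require Import zify.

Set Implicit Arguments.
Unset Strict Implicit.
Unset Printing Implicit Defensive.

Import Order.TTheory.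

(** * Why gamma is a bijection

Call a position of a word undercut when a strictly smaller letter stands
somewhere to its right.  A step of gamma exchanges the 3 and the 2 of
an occurrence of 321; the 1 of that occurrence stands to the right of both and is
smaller than both, so the two positions are undercut before and after, and no
other position changes its status.  Hence gamma preserves the
skeleton of a word: its multiset of letters, its set of undercut positions, and
the letters at all other positions (its right-to-left weak minima).  In
particular it preserves the size and the maximum.  Choosing the rightmost 321
is what keeps the word a restricted growth function (RGF): no letter between
the two exchanged ones exceeds the smaller of them.

In an RGF every value below a letter r_i already occurs before position i.  So
an RGF contains 12321 iff it contains 321, and it contains 12231 iff it contains
2231: the missing small letters in front come for free.

The bijection then follows from three facts about words with a fixed skeleton.
- At most one of them avoids 321 (same_skeleton_321_inj): the letters at
  undercut positions must increase weakly.
- At most one of them is an RGF that avoids 2231 (same_skeleton_2231_inj).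
- If one of them is an RGF, then some RGF with this skeleton avoids 2231
  (exists_2231_avoiding_skeleton): exchanging the second 2 with the 3 of a 2231,
  the 3 being well chosen, keeps the RGF property and the skeleton, and
  decreases the weight.
The second fact makes gamma injective.  For surjectivity, given a 321-avoiding
RGF q, the third yields a 12231-avoiding RGF r with the skeleton of q; both
gamma r and q avoid 321 and have this skeleton, so gamma r = q by the first. *)

(** * Pattern containment as inequalities between letters *)

(** Computes the standardization of a word with symbolic letters, once these are
    listed in increasing order. *)
Lemma std_sorted q s : sorted ltn s -> s =i q ->
  std q = [seq (index x s).+1 | x <- q].
Proof.
move=> s_lt s_q; rewrite /std; suff -> : sort leq (undup q) = s by [].
apply: (irr_sorted_eq ltn_trans ltnn) => // [|x]; last first.
  by rewrite mem_sort mem_undup s_q.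
by rewrite ltn_sorted_uniq_leq sort_uniq undup_uniq (sort_sorted leq_total).
Qed.

Lemma ltn_std q i j : i < size q -> j < size q ->
  (nth 0 (std q) i < nth 0 (std q) j) = (nth 0 q i < nth 0 q j).
Proof.
move=> iq jq; rewrite !(nth_map 0) // ltnS; set s := sort _ _.
have mem_s k : k < size q -> nth 0 q k \in s.
  by move=> kq; rewrite mem_sort mem_undup mem_nth.
have s_lt : sorted ltn s.
  by rewrite ltn_sorted_uniq_leq sort_uniq undup_uniq (sort_sorted leq_total).
have idx_lt := sorted_ltn_index ltn_trans s_lt.
apply/idP/idP => [|lt_ij]; first exact: idx_lt (mem_s _ iq) (mem_s _ jq).
rewrite ltnNge; apply/negP; rewrite leq_eqVlt => /orP[/eqP idx_ji|].
  have := congr1 (nth 0 s) idx_ji; rewrite !nth_index ?mem_s //; lia.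
move=> /(idx_lt _ _ (mem_s _ jq) (mem_s _ iq)) /=; lia.
Qed.

(** Turns a plain list of positions into the dependent tuples over which
    occurrences range. *)
Lemma occurrence_of q r s : size s = size q -> all (gtn (size r)) s ->
  sorted ltn s -> std [seq nth 0 r i | i <- s] = q ->
  exists2 u, @occurrence q r u & map val u = s.
Proof.
move=> s_q s_r s_lt std_s.
have val_s : map val (pmap (insub : nat -> option 'I_(size r)) s) = s.
  rewrite (pmap_filter (insubK _)); apply/all_filterP.
  by apply: sub_all s_r => i ir; rewrite insubT.
have sz : size (pmap (insub : nat -> option 'I_(size r)) s) == size q.
  by rewrite -(size_map val) val_s s_q.
exists (Tuple sz) => //; rewrite /occurrence /= val_s s_lt /=.
by apply/eqP; rewrite -[RHS]std_s -[in RHS]val_s -map_comp.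
Qed.

Lemma containsP q r :
  reflect (exists s, [/\ size s = size q, all (gtn (size r)) s, sorted ltn s
                       & std [seq nth 0 r i | i <- s] = q])
          (contains r q).
Proof.
apply: (iffP existsP) => [[t /andP[t_lt /eqP std_t]]|[s [s_q s_r s_lt std_s]]].
  exists (map val t); rewrite size_map size_tuple; split=> //.
    by apply/allP => _ /mapP[i _ ->] /=.
  by rewrite -map_comp.
by have [u] := occurrence_of s_q s_r s_lt std_s; exists u.
Qed.

Definition is_321 r i j k :=
  [/\ i < j, j < k, k < size r, nth 0 r k < nth 0 r j & nth 0 r j < nth 0 r i].

Definition is_2231 r h i j k :=
  [/\ h < i < j, j < k < size r, nth 0 r h = nth 0 r i,
      nth 0 r i < nth 0 r j & nth 0 r k < nth 0 r i].

Definition has_321 r := exists i j k, is_321 r i j k.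
Definition has_2231 r := exists h i j k, is_2231 r h i j k.

Lemma std_321 a b c : c < b -> b < a -> std [:: a; b; c] = [:: 3; 2; 1].
Proof.
move=> cb ba; rewrite (@std_sorted _ [:: c; b; a]) /=; first last.
- by move=> x; rewrite !inE; lia.
- by rewrite cb ba.
rewrite !eqxx (ltn_eqF cb) (ltn_eqF ba); have -> // : (c == a) = false by lia.
Qed.

Lemma std_12321 a b c : c < b -> b < a ->
  std [:: c; b; a; b; c] = [:: 1; 2; 3; 2; 1].
Proof.
move=> cb ba; rewrite (@std_sorted _ [:: c; b; a]) /=; first last.
- by move=> x; rewrite !inE; lia.
- by rewrite cb ba.
rewrite !eqxx (ltn_eqF cb) (ltn_eqF ba); have -> // : (c == a) = false by lia.
Qed.

Lemma std_12231 a b c : c < b -> b < a ->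
  std [:: c; b; b; a; c] = [:: 1; 2; 2; 3; 1].
Proof.
move=> cb ba; rewrite (@std_sorted _ [:: c; b; a]) /=; first last.
- by move=> x; rewrite !inE; lia.
- by rewrite cb ba.
rewrite !eqxx (ltn_eqF cb) (ltn_eqF ba); have -> // : (c == a) = false by lia.
Qed.

Lemma contains_321 r : contains r [:: 3; 2; 1] <-> has_321 r.
Proof.
split=> [/containsP[s [s3 s_r s_lt std_s]]|[i [j [k [ij jk kr kj ji]]]]].
  case: s s3 s_r s_lt std_s => [|i [|j [|k []]]] //= _.
  case/and4P=> ir jr kr _ /and3P[ij jk _] std_s; exists i, j, k.
  have lt_std := @ltn_std [:: nth 0 r i; nth 0 r j; nth 0 r k].
  rewrite std_s in lt_std; split=> //.
    exact: esym (lt_std 2 1 isT isT).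
  exact: esym (lt_std 1 0 isT isT).
apply/containsP; exists [:: i; j; k]; split=> //=.
- by rewrite kr !andbT; lia.
- by rewrite ij jk.
- exact: std_321.
Qed.

Lemma contains_12321_has_321 r : contains r [:: 1; 2; 3; 2; 1] -> has_321 r.
Proof.
case/containsP=> s [s5 s_r s_lt std_s].
case: s s5 s_r s_lt std_s => [|g [|h [|i [|j [|k []]]]]] //= _.
case/and5P=> _ _ ir jr /andP[kr _] /and5P[_ _ ij jk _] std_s; exists i, j, k.
have lt_std := @ltn_std [seq nth 0 r i | i <- [:: g; h; i; j; k]].
rewrite /= std_s in lt_std; split=> //.
  exact: esym (lt_std 4 3 isT isT).
exact: esym (lt_std 3 2 isT isT).
Qed.

Lemma contains_12231_has_2231 r : contains r [:: 1; 2; 2; 3; 1] -> has_2231 r.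
Proof.
case/containsP=> s [s5 s_r s_lt std_s].
case: s s5 s_r s_lt std_s => [|g [|h [|i [|j [|k []]]]]] //= _.
case/and5P=> _ _ ir jr /andP[kr _] /and5P[_ hi ij jk _] std_s.
exists h, i, j, k.
have lt_std := @ltn_std [seq nth 0 r i | i <- [:: g; h; i; j; k]].
rewrite /= std_s in lt_std; split.
- by rewrite hi.
- by rewrite jk.
- have /= := lt_std 1 2 isT isT; have /= := lt_std 2 1 isT isT; lia.
- exact: esym (lt_std 2 3 isT isT).
- exact: esym (lt_std 4 2 isT isT).
Qed.

(** * Restricted growth functions *)

(** Replaces the maximum of a prefix by a letter that attains it, so that a
    single earlier position witnesses the growth condition. *)
Lemma rgfP r : reflect
  [/\ 0 < size r, all (leq 1) r, nth 0 r 0 = 1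
    & forall i, 0 < i < size r -> exists2 j, j < i & nth 0 r i <= (nth 0 r j).+1]
  (is_rgf r).
Proof.
apply: (iffP and4P) => -[r_gt0 r_pos r_0 r_gr]; split=> //; first exact/eqP.
- move=> i /andP[i_gt0 ir]; have := (forallP r_gr) (Ordinal ir).
  rewrite i_gt0 /=; have [|j ->] := @bigop.eq_bigmax 'I_i (fun j => nth 0 r j).
    by rewrite card_ord.
  by rewrite add1n; exists j.
- exact/eqP.
apply/forallP => i; apply/implyP => i_gt0.
have [|j ji le_ij] := r_gr i; first by rewrite i_gt0 ltn_ord.
apply: leq_trans le_ij _; rewrite add1n ltnS.
exact: (@bigop.leq_bigmax _ (fun j : 'I_i => nth 0 r j) (Ordinal ji)).
Qed.

(** The prefix maximum starts at 1 and climbs by at most 1, so no value is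
    skipped on the way up to a letter. *)
Lemma rgf_value_before r i v : is_rgf r -> i < size r -> 0 < v < nth 0 r i ->
  exists2 j, j < i & nth 0 r j = v.
Proof.
case/rgfP=> _ _ r_0 r_gr; elim/ltn_ind: i => i IHi ir /andP[v_gt0 lt_vi].
have i_gt0 : 0 < i by case: i lt_vi {IHi ir} => //; rewrite r_0; lia.
have [|j ji le_ij] := r_gr i; first by rewrite i_gt0.
have [->|neq] := eqVneq v (nth 0 r j); first by exists j.
have [||k kj <-] := IHi j ji; [lia | lia | by exists k; lia].
Qed.

(** The letters 1 and 2 that 12321 has in front of 321 exist because an RGF visits
    all smaller values before the 3. *)
Lemma rgf_contains_12321 r : is_rgf r ->
  contains r [:: 1; 2; 3; 2; 1] <-> has_321 r.
Proof.
move=> rgf_r; split; first exact: contains_12321_has_321.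
case=> i [j [k [ij jk kr kj ji]]].
have [_ r_pos _ _] := rgfP _ rgf_r.
have rk_gt0 : 0 < nth 0 r k by apply: (all_nthP 0 r_pos).
have [||h hi rh] := rgf_value_before (i := i) (v := nth 0 r j) rgf_r; try lia.
have [||g gh rg] := rgf_value_before (i := h) (v := nth 0 r k) rgf_r; try lia.
apply/containsP; exists [:: g; h; i; j; k]; split=> //=.
- by rewrite kr !andbT; lia.
- by rewrite gh hi ij jk.
- by rewrite rg rh; exact: std_12321.
Qed.

(** As above, the leading 1 is found before the first 2 of a 2231. *)
Lemma rgf_contains_12231 r : is_rgf r ->
  contains r [:: 1; 2; 2; 3; 1] <-> has_2231 r.
Proof.
move=> rgf_r; split; first exact: contains_12231_has_2231.
case=> h [i [j [k [/andP[hi ij] /andP[jk kr] rh ij' ki']]]].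
have [_ r_pos _ _] := rgfP _ rgf_r.
have rk_gt0 : 0 < nth 0 r k by apply: (all_nthP 0 r_pos).
have [||g gh rg] := rgf_value_before (i := h) (v := nth 0 r k) rgf_r; try lia.
apply/containsP; exists [:: g; h; i; j; k]; split=> //=.
- by rewrite kr !andbT; lia.
- by rewrite gh hi ij jk.
- by rewrite rg rh; exact: std_12231.
Qed.

(** Of the lexicographic maximality of the chosen occurrence, only that of its
    first position is recorded: it already forbids a 321 that starts further to
    the right. *)
Lemma gamma_step_rightmost r : contains r [:: 3; 2; 1] ->
  exists i j k, [/\ is_321 r i j k,
    forall i' j' k', is_321 r i' j' k' -> i' <= i
    & gamma_step r = exchange r i j].
Proof.
rewrite -rm_contains /gamma_step /rm.
case: pickP => // t /andP[/andP[lt_t /eqP std_t] /forallP max_t] _.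
have e0 : tnth t (inord 0) = thead t by congr tnth; apply/val_inj; rewrite /= inordK.
have e1 : tnth t (inord 1) = thead (behead_tuple t).
  by rewrite /thead tnth_behead; congr tnth; apply/val_inj; rewrite /= !inordK.
rewrite {}e0 {}e1; case/tupleP: t lt_t std_t max_t => a t.
case/tupleP: t => b t; case/tupleP: t => c t; rewrite (tuple0 t) /=.
move=> /and3P[ab bc _] std_abc max_t; exists (a : nat), (b : nat), (c : nat).
have lt_std := @ltn_std [:: nth 0 r a; nth 0 r b; nth 0 r c].
rewrite std_abc in lt_std; split=> //.
- split; [exact: ab | exact: bc | exact: ltn_ord | |].
    exact: esym (lt_std 2 1 isT isT).
  exact: esym (lt_std 1 0 isT isT).
- move=> i j k [ij jk kr kj ji].
  have [||||u occ_u] := @occurrence_of [:: 3; 2; 1] r [:: i; j; k].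
  + by [].
  + by rewrite /= kr !andbT; lia.
  + by rewrite /= ij jk.
  + exact: std_321.
  have /= := max_t u; rewrite occ_u /= => le_ut.
  case/tupleP: u occ_u le_ut => x u _ le_ut [<- _].
  have : (tval [tuple of x :: u] <= [:: a; b; c] :> seqlexi 'I_(size r))%O.
    exact: le_ut.
  by rewrite /= lexi_cons => /andP[].
Qed.

(** * The skeleton of a word *)

Lemma perm_exchange r i j : i < size r -> j < size r ->
  perm_eq (exchange r i j) r.
Proof.
move=> ir jr; apply/permP => a; rewrite /exchange.
rewrite count_set_nth_ltn ?size_set_nth ?(maxn_idPr ir) //.
rewrite count_set_nth_ltn // nth_set_nth /=.
have a_i : a (nth 0 r i) <= count a r.
  case ai: (a _) => //; rewrite -has_count; apply/hasP.
  by exists (nth 0 r i); rewrite ?mem_nth.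
by case: (j == i); rewrite subnK ?addnK // (leq_trans a_i) ?leq_addr.
Qed.

Lemma exchangeK r i j : i < size r -> j < size r ->
  exchange (exchange r i j) i j = r.
Proof.
move=> ir jr; apply: (@eq_from_nth _ 0) => [|k _].
  by rewrite !size_exchange.
rewrite !nth_exchange !eqxx; case: eqVneq => [->|_] //.
  by case: eqVneq => // ->.
by case: eqVneq => // ->.
Qed.

Definition undercut r i :=
  [exists k : 'I_(size r), (i < k) && (nth 0 r k < nth 0 r i)].

Lemma undercutP r i :
  reflect (exists k, [/\ i < k, k < size r & nth 0 r k < nth 0 r i])
          (undercut r i).
Proof.
apply: (iffP existsP) => [[k /andP[]]|[k [ik kr ki]]]; first by exists k.
by exists (Ordinal kr); rewrite /= ik.
Qed.

Definition same_skeleton r s :=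
  [/\ perm_eq r s, undercut r =1 undercut s
    & forall i, ~~ undercut r i -> nth 0 r i = nth 0 s i].

Lemma same_skeleton_sym r s : same_skeleton r s -> same_skeleton s r.
Proof.
by case=> rs u_rs eq_rs; split=> [|i|i]; rewrite -?u_rs 1?perm_sym // => /eq_rs.
Qed.

Lemma same_skeleton_trans s r t :
  same_skeleton r s -> same_skeleton s t -> same_skeleton r t.
Proof.
move=> [rs u_rs eq_rs] [st u_st eq_st]; split=> [|i|i nu].
- exact: perm_trans rs st.
- by rewrite u_rs u_st.
- by rewrite eq_rs // eq_st // -u_rs.
Qed.

(** Position k holds a letter smaller than both exchanged ones, and stands to the
    right of both: it undercuts i and j before and after, and it takes over from
    i or j wherever one of them was the witness that a position is undercut. *)
Lemma same_skeleton_exchange r i j k : i < j -> j < k -> k < size r ->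
  nth 0 r k < nth 0 r i -> nth 0 r k < nth 0 r j ->
  same_skeleton r (exchange r i j).
Proof.
move=> ij jk kr ki kj; have [jr ir] : j < size r /\ i < size r by lia.
have sz := size_exchange ir jr.
have e_k : nth 0 (exchange r i j) k = nth 0 r k.
  by rewrite nth_exchange !ifN //; lia.
have u_i : undercut r i by apply/undercutP; exists k; split=> //; lia.
have u_j : undercut r j by apply/undercutP; exists k.
have u_rs l : undercut r l = undercut (exchange r i j) l.
  have [->|li] := eqVneq l i.
    rewrite u_i; apply/esym/undercutP; exists k; rewrite sz e_k nth_exchange.
    by rewrite (ltn_eqF ij) eqxx; split=> //; lia.
  have [->|lj] := eqVneq l j.
    rewrite u_j; apply/esym/undercutP; exists k; rewrite sz e_k nth_exchange.
    by rewrite eqxx.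
  have e_l : nth 0 (exchange r i j) l = nth 0 r l by rewrite nth_exchange !ifN.
  apply/undercutP/undercutP; rewrite sz e_l => -[m [lm mr ml]].
    have [mi|mi] := eqVneq m i.
      by exists j; rewrite nth_exchange eqxx -mi; split=> //; lia.
    have [mj|mj] := eqVneq m j.
      by exists k; rewrite e_k -?mj in kj *; split=> //; lia.
    by exists m; rewrite nth_exchange !ifN.
  move: ml; rewrite nth_exchange; case: eqVneq => [mj|mj] ml.
    by exists k; split=> //; lia.
  move: ml; case: eqVneq => [mi|mi] ml; last by exists m.
  by exists j; split=> //; lia.
split=> //; first by rewrite perm_sym perm_exchange.
by move=> l nu; rewrite nth_exchange !ifN //; apply: contraNneq nu => ->.
Qed.

(** An exchange raises prefix maxima when it moves the larger letter to the left;
    when it moves the smaller letter w j to the left, the letters in between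
    lose their support w i, but being at most w j they are supported by the
    letter newly placed at i.  From j onwards the prefix maxima are unchanged. *)
Lemma rgf_exchange r i j (w := nth 0 r) : is_rgf r -> 0 < i < j -> j < size r ->
    (exists2 l, l < i & maxn (w i) (w j) <= (w l).+1) ->
    w i < w j \/ (forall l, i < l < j -> w l <= w j) ->
  is_rgf (exchange r i j).
Proof.
move=> /rgfP[r_gt0 r_pos r_0 r_gr] /andP[i_gt0 ij] jr [l li le_l] between.
have ir := ltn_trans ij jr.
apply/rgfP; split.
- by rewrite size_exchange.
- by rewrite (perm_all _ (perm_exchange ir jr)).
- by rewrite nth_exchange !ifN //; lia.
rewrite size_exchange // => m m_r.
have e n : n != i -> n != j -> nth 0 (exchange r i j) n = w n.
  by move=> ni nj; rewrite nth_exchange !ifN.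
have e_i : nth 0 (exchange r i j) i = w j by rewrite nth_exchange eqxx (ltn_eqF ij).
have e_j : nth 0 (exchange r i j) j = w i by rewrite nth_exchange eqxx.
have [mi|neq_mi] := eqVneq m i; first by exists l; rewrite ?mi // e_i e; lia.
have [mj|neq_mj] := eqVneq m j.
  by exists l; rewrite ?mj ?e_j ?e; lia.
rewrite e //; have [n nm le_n] := r_gr m m_r; rewrite -/(w _) -/(w _) in le_n.
have [n_i|n_i] := eqVneq n i; last first.
  have [n_j|n_j] := eqVneq n j; last by exists n; rewrite ?e.
  by exists i; rewrite ?e_i -?n_j; lia.
rewrite n_i in nm le_n; have [lt_jm|le_mj] := ltnP j m.
  by exists j; rewrite ?e_j.
exists i; rewrite ?e_i //; case: between => [|/(_ m)]; lia.
Qed.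

(** A letter above the 2 and strictly between the 3 and the 2 of the chosen
    occurrence would start a 321 further to the right; this is the betweenness
    condition of rgf_exchange. *)
Lemma rgf_gamma_step r : is_rgf r ->
  is_rgf (gamma_step r) /\ same_skeleton r (gamma_step r).
Proof.
move=> rgf_r; have [c|nc] := boolP (contains r [:: 3; 2; 1]); last first.
  have -> : gamma_step r = r.
    by move: nc; rewrite -rm_contains /gamma_step; case: (rm _ _).
  by split.
have [i [j [k [[ij jk kr kj ji] max_i ->]]]] := gamma_step_rightmost c.
have [r_gt0 r_pos r_0 r_gr] := rgfP _ rgf_r.
have i_gt0 : 0 < i by rewrite lt0n; apply: contraTneq ji => ->; lia.
split; last by apply: (same_skeleton_exchange ij jk) => //; lia.
apply: rgf_exchange => //; try lia.
  by have [|l li le_l] := r_gr i; [lia | exists l; lia].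
right=> l /andP[il lj]; rewrite leqNgt; apply/negP => jl.
suff /max_i : is_321 r l j k by lia.
by [].
Qed.

Lemma gammaP r : is_rgf r ->
  [/\ is_rgf (gamma r), same_skeleton r (gamma r) & ~ has_321 (gamma r)].
Proof.
move=> rgf_r; rewrite /gamma; case: ex_minnP => m av_m _.
have inv n : is_rgf (iter n gamma_step r) /\
             same_skeleton r (iter n gamma_step r).
  elim: n => [|n [rgf_n sk_n]]; first by split.
  have [rgf_Sn sk_Sn] := rgf_gamma_step rgf_n.
  by split=> //; apply: same_skeleton_trans sk_n sk_Sn.
have [? ?] := inv m; split=> //.
by move/contains_321; apply/negP.
Qed.

(** * Uniqueness of a pattern-avoiding word with a given skeleton *)

(** Two words with the same skeleton can only differ at undercut positions, and at
    the last difference the letters used so far form the same multiset in both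
    words. *)
Lemma last_difference r s : same_skeleton r s -> r != s ->
  exists p, [/\ nth 0 r p != nth 0 s p, undercut r p, undercut s p,
    (forall k, p < k -> nth 0 r k = nth 0 s k)
    & perm_eq (take p.+1 r) (take p.+1 s)].
Proof.
move=> [rs u_rs eq_rs] neq_rs; have sz := perm_size rs.
have exP : exists p, nth 0 r p != nth 0 s p.
  have [/existsP[i]|/existsPn eq] :=
    boolP [exists i : 'I_(size r), nth 0 r i != nth 0 s i]; first by exists i.
  case/eqP: neq_rs; apply: (@eq_from_nth _ 0) => // i ir.
  exact/eqP/negPn/(eq (Ordinal ir)).
have ubP p : nth 0 r p != nth 0 s p -> p <= size r.
  by apply: contraR; rewrite -ltnNge => /ltnW lt; rewrite !nth_default -?sz.
case: (ex_maxnP exP ubP) => p neq max_p.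
have eq_after k : p < k -> nth 0 r k = nth 0 s k.
  by move=> pk; apply/eqP; apply: contraTT pk => /max_p; rewrite -leqNgt.
have u_p : undercut r p by apply: contraNT neq => /eq_rs ->.
exists p; split=> //; first by rewrite -u_rs.
rewrite -(perm_cat2r (drop p.+1 r)) cat_take_drop.
have -> : drop p.+1 r = drop p.+1 s.
  apply: (@eq_from_nth _ 0) => [|i _]; first by rewrite !size_drop sz.
  by rewrite !nth_drop eq_after //; lia.
by rewrite cat_take_drop.
Qed.

(** The letter that s has at p is still to be used by r, and r does not use it
    at p itself. *)
Lemma value_before_last_difference r s p :
    perm_eq (take p.+1 r) (take p.+1 s) -> p < size s ->
    nth 0 r p != nth 0 s p ->
  exists2 i, i < p & nth 0 r i = nth 0 s p.
Proof.
move=> rs ps neq; have : nth 0 s p \in take p.+1 s.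
  by rewrite -{1}(nth_take 0 (ltnSn p)) mem_nth // size_take_min; lia.
rewrite -(perm_mem rs) => /(nthP 0)[i]; rewrite size_take_min leq_min.
case/andP=> ip _; rewrite nth_take // => e_i; exists i => //.
suff : i != p by lia.
by apply: contraNneq neq => eq_ip; rewrite -e_i eq_ip.
Qed.

Lemma count_mem_gt1P (x : nat) s :
  reflect (exists i j, [/\ i < j, j < size s, nth 0 s i = x & nth 0 s j = x])
          (1 < count_mem x s).
Proof.
elim: s => [|y s IHs] /=; first by constructor=> -[i [j []]].
have [->|neq] := eqVneq y x.
  rewrite add1n ltnS -has_count has_pred1.
  apply: (iffP (nthP 0)) => [[j js e]|[i [[|j] [ij js _ e]]]] //.
    by exists 0, j.+1.
  by exists j.
rewrite add0n; apply: (iffP IHs) => [[i [j [ij js ei ej]]]|].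
  by exists i.+1, j.+1.
case=> i [[|j] [ij js ei ej]] //; case: i ij ei => [_ ei|i ij ei].
  by rewrite -ei eqxx in neq.
by exists i, j.
Qed.

(** At the last difference p, the word with the smaller letter at p holds the
    larger one somewhere before p.  Together with the letter that undercuts p
    they form a 321. *)
Lemma same_skeleton_321_inj r s :
  same_skeleton r s -> ~ has_321 r -> ~ has_321 s -> r = s.
Proof.
have main t u p : ~ has_321 t -> perm_eq (take p.+1 t) (take p.+1 u) ->
    undercut t p -> p < size u -> nth 0 t p < nth 0 u p -> False.
  move=> no_321 tu /undercutP[k [pk kt kp]] pu lt_p; apply: no_321.
  have [|i ip e_i] := value_before_last_difference tu pu; first by lia.
  by exists i, p, k; split=> //; lia.
move=> sk no_r no_s; have [//|neq] := eqVneq r s; exfalso.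
have [p [neq_p u_r u_s _ rs]] := last_difference sk neq.
have pr : p < size r by case/undercutP: u_r => k [pk k_lt _]; exact: ltn_trans k_lt.
have ps : p < size s by case/undercutP: u_s => k [pk k_lt _]; exact: ltn_trans k_lt.
case: (ltngtP (nth 0 r p) (nth 0 s p)) neq_p => // lt_p _.
  exact: main lt_p.
by apply: main lt_p => //; rewrite perm_sym.
Qed.

(** Let t have the smaller letter b, and u the larger letter b', at their last
    difference p.  In t the letter b' occurs before p, hence so does b, t being
    an RGF: b occurs twice up to p.  So it does in u, where both occurrences
    precede p; with b' at p and the letter undercutting p they form a 2231. *)
Lemma same_skeleton_2231_inj r s : is_rgf r -> is_rgf s ->
  same_skeleton r s -> ~ has_2231 r -> ~ has_2231 s -> r = s.
Proof.
have main t u p : is_rgf t -> ~ has_2231 u ->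
    perm_eq (take p.+1 t) (take p.+1 u) ->
    (forall k, p < k -> nth 0 t k = nth 0 u k) -> undercut t p ->
    size t = size u -> nth 0 t p < nth 0 u p -> False.
  move=> rgf_t no_2231 tu eq_tu /undercutP[k [pk kt kp]] sz lt_p.
  have pu : p < size u by lia.
  have t_gt0 : 0 < nth 0 t p by lia.
  have [|i ip e_i] := value_before_last_difference tu pu; first by lia.
  have [||j ji e_j] := rgf_value_before (i := i) (v := nth 0 t p) rgf_t; try lia.
  have : 1 < count_mem (nth 0 t p) (take p.+1 u).
    rewrite -(permP tu); apply/count_mem_gt1P; exists j, p.
    by rewrite size_take_min !nth_take //; [split=> //|]; lia.
  case/count_mem_gt1P=> h [l [hl]]; rewrite size_take_min => l_lt.
  rewrite !nth_take; try lia; move=> e_h e_l; apply: no_2231.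
  have l_p : l != p by apply/eqP=> eq_lp; rewrite eq_lp in e_l; lia.
  by exists h, l, p, k; rewrite /is_2231 -(eq_tu k) // e_h e_l; split=> //; lia.
move=> rgf_r rgf_s sk no_r no_s; have [//|neq] := eqVneq r s; exfalso.
have [p [neq_p u_r u_s eq_rs rs]] := last_difference sk neq.
have sz : size r = size s by case: sk => /perm_size.
case: (ltngtP (nth 0 r p) (nth 0 s p)) neq_p => // lt_p _.
  exact: main lt_p.
by apply: (main s r) lt_p => // [|k /eq_rs]; rewrite // perm_sym.
Qed.

(** * Existence of a 2231-avoiding RGF with a given skeleton *)

(** Let b at positions h < i be the two 2s of a 2231.  The letter to move to
    position i is the first one after i that exceeds b, at m: everything between
    i and m is at most b, which already occurs at h, so the prefix before i
    supports the letter at m.  Moving the larger letter to the left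
    decreases the weight. *)
Lemma rgf_2231_exchange r : is_rgf r -> contains r [:: 1; 2; 2; 3; 1] ->
  exists s, [/\ is_rgf s, same_skeleton r s & weight s < weight r].
Proof.
move=> rgf_r /(rgf_contains_12231 rgf_r).
case=> h [i [j [k [/andP[hi ij] /andP[jk kr] r_h ij' ki]]]].
have [_ _ r_0 r_gr] := rgfP _ rgf_r.
(* m <= j < k, so position k undercuts both exchanged positions. *)
have above : exists l, (i < l) && (nth 0 r i < nth 0 r l) by exists j; rewrite ij.
case: (ex_minnP above) => m /andP[im lt_im] min_m.
have mj : m <= j by apply: min_m; rewrite ij.
have mr : m < size r by lia.
have [ir mk] : i < size r /\ m < k by lia.
have sz := size_exchange ir mr.
exists (exchange r i m); split; last first.
- rewrite -[X in _ < weight X](exchangeK ir mr); apply: weight_exchange => //.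
    by rewrite sz.
  by rewrite !nth_exchange !eqxx (ltn_eqF im).
- by apply: (same_skeleton_exchange im mk kr); lia.
apply: rgf_exchange => //; try lia.
have [|n nm le_n] := r_gr m; first lia.
have [ni|le_in] := ltnP n i; first by exists n; lia.
have le_ni : nth 0 r n <= nth 0 r i.
  have [->//|neq] := eqVneq n i.
  by rewrite leqNgt; apply/negP => lt; have := min_m n; rewrite lt; lia.
by exists h; lia.
Qed.

Lemma exists_2231_avoiding_skeleton r : is_rgf r ->
  exists s, [/\ is_rgf s, same_skeleton r s & avoids s [:: 1; 2; 2; 3; 1]].
Proof.
have [n] := ubnP (weight r); elim: n r => // n IHn r lt_n rgf_r.
have [c|nc] := boolP (contains r [:: 1; 2; 2; 3; 1]); last by exists r.
have [s [rgf_s rs lt_sr]] := rgf_2231_exchange rgf_r c.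
have [|t [rgf_t st av_t]] := IHn s _ rgf_s; first lia.
by exists t; split=> //; apply: same_skeleton_trans rs st.
Qed.

(** * The bijection *)

Theorem theorem5p17 :
  [/\ set_bij (RGF_avoiding [:: 1; 2; 2; 3; 1])
              (RGF_avoiding [:: 1; 2; 3; 2; 1]) gamma,
      forall R : seq nat, RGF_avoiding [:: 1; 2; 2; 3; 1] R ->
        size (gamma R) = size R
    & forall R : seq nat, RGF_avoiding [:: 1; 2; 2; 3; 1] R ->
        \max_(x <- gamma R) x = \max_(x <- R) x].
Proof.
split; first split.
- move=> r /andP[/gammaP[rgf_g _ no_321] _]; rewrite /RGF_avoiding /= rgf_g /=.
  by apply/negP => /contains_12321_has_321.
- move=> r s; rewrite !in_setE => /andP[rgf_r av_r] /andP[rgf_s av_s] eq_g.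
  have [_ sk_r _] := gammaP rgf_r; have [_ sk_s _] := gammaP rgf_s.
  apply: same_skeleton_2231_inj => //.
  + rewrite -eq_g in sk_s; exact: same_skeleton_trans sk_r (same_skeleton_sym sk_s).
  + by move/(rgf_contains_12231 rgf_r); apply/negP.
  + by move/(rgf_contains_12231 rgf_s); apply/negP.
- move=> q /andP[rgf_q av_q].
  have [r [rgf_r qr av_r]] := exists_2231_avoiding_skeleton rgf_q.
  exists r; first by rewrite /RGF_avoiding /= rgf_r.
  have [_ rg no_321] := gammaP rgf_r.
  apply: same_skeleton_321_inj no_321 _.
    exact: same_skeleton_sym (same_skeleton_trans qr rg).
  by move/(rgf_contains_12321 rgf_q); apply/negP.
- by move=> r /andP[/gammaP[_ [/perm_size-> _ _] _] _].
- by move=> r /andP[/gammaP[_ [rg _ _] _] _]; apply/esym/perm_big.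
Qed.
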